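(* There exists a family of c-connected non-flat clustered graphs $C(G,T)$ with planar underlying graph $G$ on $n$ vertices, for arbitrarily large $n$, such that $\beta\in\Omega(n^2)$ in every $\langle 0,\beta,0\rangle$-drawing of $C(G,T)$.
   Context: A clustered graph $C(G,T)$ consists of a graph $G$ and a rooted tree $T$ whose leaves are exactly the vertices of $G$; each internal node $\mu$ of $T$ is a cluster, identified with the set of leaves of its subtree. $C(G,T)$ is c-connected if for every cluster the subgraph of $G$ induced by its vertices is connected; it is flat if no cluster other than the root contains another cluster (non-flat otherwise). A drawing of $C(G,T)$ maps vertices to distinct points, edges to open curves between their endpoints, and each cluster $\mu$ to a simple closed region $R(\mu)$ containing all and only the vertices of $\mu$, with $R(\nu)\supseteq R(\mu)$ whenever $\mu$ is a descendant of $\nu$. Intersections among curves are isolated points, no three curves meet at a point, and two curves alternate around each intersection point. Edge-edge crossings are crossings between two edges; an edge crossing the boundary of $R(\mu)$ exactly $k$ times contributes $\lfloor k/2\rfloor$ edge-region crossings; for clusters $\mu,\nu$ neither an ancestor of the other, the number of region-region crossings is the number of connected components of $R(\mu)\setminus R(\nu)$ minus one. A $\langle 0,\beta,0\rangle$-drawing is a drawing with exactly $\beta$ edge-region crossings and no edge-edge or region-region crossings. *)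

(* Defs.v *)
From HB Require Import structures.
From mathcomp Require Import all_boot all_order all_algebra.
From mathcomp Require Import all_classical all_reals all_analysis.

Set Implicit Arguments.
Unset Strict Implicit.
Unset Printing Implicit Defensive.

Import Order.TTheory GRing.Theory Num.Theory.
Import numFieldNormedType.Exports.

Record graph := Graph {
  vertex : finType;
  adj : rel vertex;
  adj_sym : symmetric adj;
  adj_irr : irreflexive adj
}.

Definition edges (G : graph) : {set {set vertex G}} :=
  [set e : {set vertex G} |
    [exists x, exists y, adj x y && (e == [set x; y]%SET)]]%SET.

Definition edge (G : graph) := {e : {set vertex G} | e \in edges G}.

Definition induced_adj (G : graph) (A : {set vertex G}) : rel (vertex G) :=
  [rel x y | [&& x \in A, y \in A & adj x y]].

Definition connected_in (G : graph) (A : {set vertex G}) : bool :=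
  [forall x in A, forall y in A, connect (induced_adj A) x y].

(* The root is, by convention, its own parent; as every node reaches the root,
   this is the only cycle of the parent function. *)
Record rooted_tree := RootedTree {
  node : finType;
  root : node;
  parent : node -> node;
  parent_root : parent root = root;
  parent_reach : forall x, fconnect parent x root
}.

(* y = x is allowed. *)
Definition descendant (T : rooted_tree) (y x : node T) : bool :=
  fconnect (@parent T) y x.

Definition is_leaf (T : rooted_tree) (x : node T) : bool :=
  [forall y, (parent y == x) ==> (y == root T)].

Definition leaves_below (G : graph) (T : rooted_tree)
    (leaf : vertex G -> node T) (mu : node T) : {set vertex G} :=
  [set v | descendant (leaf v) mu]%SET.

(* [cg_inj]: internal nodes are identified with their sets of leaves, so
   distinct internal nodes have distinct sets of leaves.  Without it, long
   chains of nodes with one child would yield arbitrarily many copies of one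
   cluster. *)
Record clustered_graph := ClusteredGraph {
  cg_graph : graph;
  cg_tree : rooted_tree;
  cg_leaf : vertex cg_graph -> node cg_tree;
  cg_leaf_inj : injective cg_leaf;
  cg_leafP : forall x, is_leaf x <-> exists v, cg_leaf v = x;
  cg_inj : {in [pred x | ~~ is_leaf x] &, injective (leaves_below cg_leaf)}
}.

Section Clusters.
Variable C : clustered_graph.
Local Notation V := (vertex (cg_graph C)).
Local Notation T := (cg_tree C).

Definition cg_order : nat := #|V|.

Definition cg_cluster := {mu : node T | ~~ is_leaf mu}.

Definition cluster_set (mu : cg_cluster) : {set V} :=
  leaves_below (@cg_leaf C) (val mu).

Definition c_connected : bool :=
  [forall mu : cg_cluster, connected_in (cluster_set mu)].

Definition flat : bool :=
  [forall mu : cg_cluster, forall nu : cg_cluster,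
    (val mu != root T) && (nu != mu) ==>
      ~~ (cluster_set nu \subset cluster_set mu)].

End Clusters.

Local Open Scope classical_set_scope.
Local Open Scope ring_scope.

Section Plane.
Variable R : realType.

Definition simple_arc (g : R -> R * R) : Prop :=
  {within `[0, 1], continuous g} /\ {in `[0, 1]%R &, injective g}.

Definition open_curve (g : R -> R * R) : set (R * R) := g @` `]0, 1[.

Definition unit_disc : set (R * R) := [set z | z.1 ^+ 2 + z.2 ^+ 2 <= 1].

(* A closed topological disc, i.e. a simple closed curve with its inside. *)
Definition simple_closed_region (A : set (R * R)) : Prop :=
  exists f : R * R -> R * R,
    [/\ {within unit_disc, continuous f},
        {in unit_disc &, injective f} & A = f @` unit_disc].

Definition boundary (A : set (R * R)) : set (R * R) :=
  closure A `\` interior A.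

(* The four branches of A and B leaving p alternate around p: in a suitable
   chart of an open neighbourhood of p, A is the first axis and B is the
   second one. *)
Definition alternate (A B : set (R * R)) (p : R * R) : Prop :=
  exists h : R * R -> R * R,
    [/\ continuous h /\ injective h,
        forall U : set (R * R), open U -> open (h @` U),
        h (0, 0) = p,
        h @^-1` A = [set z | z.2 = 0] &
        h @^-1` B = [set z | z.1 = 0]].

Record graph_drawing (G : graph) := GraphDrawing {
  vertex_point : vertex G -> R * R;
  edge_arc : edge G -> R -> R * R;
  vertex_point_inj : injective vertex_point;
  edge_arc_simple : forall e, simple_arc (edge_arc e);
  edge_arc_ends : forall e,
    [set edge_arc e 0; edge_arc e 1] = vertex_point @` [set v | v \in val e];
  edge_arc_vertex : forall e v, ~ open_curve (edge_arc e) (vertex_point v)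
}.

Definition no_edge_edge_crossing (G : graph) (D : graph_drawing G) : Prop :=
  forall e f : edge G, e != f ->
    open_curve (edge_arc D e) `&` open_curve (edge_arc D f) = set0.

Definition planar (G : graph) : Prop :=
  exists D : graph_drawing G, no_edge_edge_crossing D.

(* The curves of a drawing: open edges and boundaries of regions. *)
Definition curve (C : clustered_graph) (D : graph_drawing (cg_graph C))
    (reg : cg_cluster C -> set (R * R)) (i : edge (cg_graph C) + cg_cluster C) :
    set (R * R) :=
  match i with
  | inl e => open_curve (edge_arc D e)
  | inr mu => boundary (reg mu)
  end.

(* [region_boundary]: vertices are in general position with respect to the
   boundaries; otherwise an edge could leave a region through one of its
   endpoints without any crossing. *)
Record drawing (C : clustered_graph) := Drawing {
  draw_graph :> graph_drawing (cg_graph C);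
  region : cg_cluster C -> set (R * R);
  region_simple : forall mu, simple_closed_region (region mu);
  region_vertex : forall mu v,
    region mu (vertex_point draw_graph v) <-> v \in cluster_set mu;
  region_boundary : forall mu v, ~ boundary (region mu) (vertex_point draw_graph v);
  region_sub : forall mu nu : cg_cluster C,
    descendant (val mu) (val nu) -> region mu `<=` region nu;
  curves_isolated : forall i j, i != j ->
    let X := curve draw_graph region i `&` curve draw_graph region j in
    X `<=` isolated X;
  curves_no_three : forall i j k, i != j -> j != k -> i != k ->
    curve draw_graph region i `&` curve draw_graph region j
      `&` curve draw_graph region k = set0;
  curves_alternate : forall i j p, i != j ->
    curve draw_graph region i p -> curve draw_graph region j p ->
    alternate (curve draw_graph region i) (curve draw_graph region j) p
}.

Section Crossings.
Variables (C : clustered_graph) (D : drawing C).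

Definition boundary_crossings (e : edge (cg_graph C)) (mu : cg_cluster C) :
    set (R * R) :=
  open_curve (edge_arc D e) `&` boundary (region D mu).

Definition edge_region_crossings (beta : nat) : Prop :=
  exists k : edge (cg_graph C) -> cg_cluster C -> nat,
    (forall e mu, (boundary_crossings e mu #= `I_(k e mu))%card) /\
    beta = (\sum_(e : edge (cg_graph C)) \sum_(mu : cg_cluster C) (k e mu)./2)%N.

Definition components (A : set (R * R)) : set (set (R * R)) :=
  [set connected_component A x | x in A].

Definition region_region_crossings (mu nu : cg_cluster C) (gamma : nat) : Prop :=
  (components (region D mu `\` region D nu) #= `I_gamma.+1)%card.

Definition no_region_region_crossing : Prop :=
  forall mu nu : cg_cluster C,
    ~~ descendant (val mu) (val nu) -> ~~ descendant (val nu) (val mu) ->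
    region_region_crossings mu nu 0.

(* D is a <0,beta,0>-drawing. *)
Definition drawing_0_beta_0 (beta : nat) : Prop :=
  [/\ no_edge_edge_crossing D, edge_region_crossings beta &
      no_region_region_crossing].

End Crossings.
End Plane.

(* Main.v *)
(** Glue copies ("petals") of K5 minus an edge at a common vertex, and let a
    chain of nested clusters contain all the triangles opposite to the missing
    edges, absorbing the two endpoints of one missing edge at a time.  In a
    planar drawing of a petal the triangle separates these two endpoints, so it
    cannot stay inside a topological disc avoiding both: each cluster is left
    by an edge of every petal whose missing edge it has not absorbed yet, which
    gives quadratically many edge-region crossings.

    The separation is proved with angles rather than with the Jordan curve
    theorem.  For disjoint paths c and e, the map (s, t) |-> c s - e t on the
    unit square has no zero, hence lifts to an angle; this is a linear relation
    between the total turnings of c around the endpoints of e and conversely.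
    Likewise a closed path in a disc has turning zero around each point off the
    disc.  Added up over the independent pairs of edges, these relations
    contradict each other modulo 2. *)

Require Import Defs.
From mathcomp Require Import all_boot all_order all_algebra.
From mathcomp Require Import all_classical all_reals all_analysis.
From mathcomp Require Import zify ring lra.

Set Implicit Arguments.
Unset Strict Implicit.
Unset Printing Implicit Defensive.

Import Order.TTheory GRing.Theory Num.Theory.
Import numFieldNormedType.Exports.

Local Open Scope classical_set_scope.
Local Open Scope ring_scope.

(** * Polar angles of nonzero plane vectors *)

Section Angles.
Variable R : realType.
Implicit Types (a b x : R) (u v w : R * R).

Definition has_angle a v := exists2 r, 0 < r & v = (r * cos a, r * sin a).

Definition dotp u v : R := u.1 * v.1 + u.2 * v.2.
Definition crossp u v : R := u.1 * v.2 - u.2 * v.1.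

Lemma dotp_gt0 v : v != 0 -> 0 < dotp v v.
Proof.
case: v => p q v0; rewrite /dotp /= -!expr2 lt_neqAle addr_ge0 ?sqr_ge0// andbT.
apply: contra v0; rewrite eq_sym paddr_eq0 ?sqr_ge0// !sqrf_eq0.
by move=> /andP[/eqP -> /eqP ->].
Qed.

Lemma has_angle_exists v : v != 0 -> exists a, has_angle a v.
Proof.
move=> /dotp_gt0; case: v => p q; rewrite /dotp /= -!expr2 => s0.
set r := Num.sqrt (p ^+ 2 + q ^+ 2).
have r0 : 0 < r by rewrite sqrtr_gt0.
have r2 : r ^+ 2 = p ^+ 2 + q ^+ 2 by rewrite sqr_sqrtr// ltW.
have rn0 : r != 0 by rewrite gt_eqF.
have pr : (p / r) ^+ 2 + (q / r) ^+ 2 = 1.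
  by rewrite !expr_div_n -mulrDl r2 divff// -r2 sqrf_eq0.
have pr1 : -1 <= p / r <= 1.
  rewrite -ler_norml -(@expr_le1 _ 2)// real_normK ?num_real// -pr.
  by rewrite lerDl sqr_ge0.
have sq : Num.sqrt (1 - (p / r) ^+ 2) = `|q / r|.
  by rewrite -pr addrC addKr sqrtr_sqr.
have [q0|q0] := leP 0 q.
- exists (acos (p / r)), r => //; rewrite acosK// ?in_itv//= sin_acos// sq.
  by rewrite ger0_norm ?divr_ge0 ?(ltW r0)// !(mulrC r) !divfK.
- exists (- acos (p / r)), r => //.
  rewrite cosN sinN acosK// ?in_itv//= sin_acos// sq.
  by rewrite ltr0_norm ?pmulr_llt0 ?invr_gt0// opprK !(mulrC r) !divfK.
Qed.

Lemma has_angle_uniq a b v : has_angle a v -> has_angle b v -> cos (a - b) = 1.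
Proof.
move=> [r r0 ->] [s s0 [E1 E2]].
have c2 := cos2Dsin2 a; have d2 := cos2Dsin2 b.
have rs : r = s.
  apply/eqP; rewrite -(@eqrXn2 _ 2) ?ltW//; apply/eqP.
  rewrite -[LHS]mulr1 -c2 -[RHS]mulr1 -d2 !mulrDr -!exprMn.
  by rewrite E1 E2.
have rn0 : s != 0 by rewrite gt_eqF.
move: E1 E2; rewrite rs => /(mulfI rn0) E1 /(mulfI rn0) E2.
by rewrite cosB E1 E2 -!expr2.
Qed.

Lemma has_angle_addpi a v : has_angle a v -> has_angle (a + pi) (- v).
Proof.
move=> [r r0 ->]; exists r => //.
by rewrite cosDpi sinDpi !mulrN.
Qed.

(** A positive dot product puts [v] within a quarter turn of [u], where the arctangent of cross over
    dot product is the exact angle from [u] to [v]. *)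
Lemma has_angle_step a u v : has_angle a u -> 0 < dotp u v ->
  has_angle (a + atan (crossp u v / dotp u v)) v.
Proof.
move=> [r r0 ->] d0; set d := dotp _ _ in d0 *; set c := crossp _ _.
have dn0 : d != 0 by rewrite gt_eqF.
have rn0 : r != 0 by rewrite gt_eqF.
have c0 : 0 < cos (atan (c / d)) by rewrite cos_gt0_pihalf// atan_gtNpi2 atan_ltpi2.
have st : sin (atan (c / d)) = c / d * cos (atan (c / d)).
  by rewrite -{2}(atanK (c / d)) /tan divfK// gt_eqF.
exists (d / (r * cos (atan (c / d)))); first by rewrite divr_gt0// mulr_gt0.
rewrite cosD sinD st; set k := cos (atan _) in c0 *.
have kn0 : k != 0 by rewrite gt_eqF.
have := cos2Dsin2 a; set C := cos a; set S := sin a => CS.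
(* Up to the factor [r], [d] and [c] are the coordinates of [v] in the frame rotated by [a]; [E1]
   and [E2] rotate back. *)
have dE : d = r * (C * v.1 + S * v.2) by rewrite /d /dotp /C /S /=; ring.
have cE : c = r * (C * v.2 - S * v.1) by rewrite /c /crossp /C /S /=; ring.
have E1 : d / (r * k) * (C * k - S * (c / d * k)) = v.1.
  have -> : d / (r * k) * (C * k - S * (c / d * k)) = (d * C - c * S) / r by field; rewrite rn0 kn0 dn0.
  rewrite dE cE; apply/(canLR (mulfK rn0)).
  by rewrite -[RHS]mul1r -CS; ring.
have E2 : d / (r * k) * (S * k + C * (c / d * k)) = v.2.
  have -> : d / (r * k) * (S * k + C * (c / d * k)) = (d * S + c * C) / r by field; rewrite rn0 kn0 dn0.
  rewrite dE cE; apply/(canLR (mulfK rn0)).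
  by rewrite -[RHS]mul1r -CS; ring.
by rewrite E1 E2 -surjective_pairing.
Qed.

Lemma cos_lt1 x : 0 < x <= pi -> cos x < 1.
Proof.
move=> /andP[x0 xpi]; rewrite -cos0 ltr_cos// in_itv/= ?lexx ?pi_ge0//.
by rewrite (ltW x0).
Qed.

Lemma cos_eq1_int x : cos x = 1 -> exists n : int, x = n%:~R * (pi *+ 2).
Proof.
move=> cx; have p0 := pi_gt0 R.
have pp : 0 < pi *+ 2 :> R by lra.
pose n := Num.floor (x / (pi *+ 2)); exists n.
have /andP[n1 n2] := floor_itv (x / (pi *+ 2)).
set y := x - n%:~R * (pi *+ 2).
have cy : cos y = 1.
  rewrite /y; case: (n) => k; rewrite ?NegzE ?rmorphN /=.
    rewrite -[RHS]cx -pmulrn.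
    by rewrite mulr_natl -(periodicn (@cosD2pi R) k (x - _)) subrK.
  by rewrite mulNr opprK mulr_natl (periodicn (@cosD2pi R)).
have y0 : 0 <= y by rewrite subr_ge0 -ler_pdivlMr.
have y1 : y < pi *+ 2.
  by rewrite ltrBlDr -{1}[pi *+ 2]mul1r -mulrDl -ltr_pdivrMr// addrC -[1]/(1%:~R) -intrD.
have [y00|] := eqVneq y 0; first by move/eqP: y00; rewrite subr_eq0 => /eqP.
rewrite -[_ != _]negbK => yn0; exfalso.
have {}y0 : 0 < y by rewrite lt_neqAle y0 eq_sym -[_ != _]negbK yn0.
(* [cos_lt1] covers half of the period; the other half follows by reflecting [y] to
   [pi *+ 2 - y]. *)
have [ypi|ypi] := leP y pi.
  have : cos y < 1 by rewrite cos_lt1// y0 ypi.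
  by rewrite cy ltxx.
have : cos (pi *+ 2 - y) < 1 by rewrite cos_lt1//; apply/andP; split; lra.
by rewrite cosB cos2pi sin2pi mul0r addr0 mul1r cy ltxx.
Qed.

End Angles.

(** * Continuous angle lifts over compact star-shaped sets *)

Section AngleLift.
Variable R : realType.
Implicit Types (F : R * R -> R * R) (K : set (R * R)).

Lemma continuous_dotp (T : topologicalType) (f g : T -> R * R) x :
  {for x, continuous f} -> {for x, continuous g} ->
  {for x, continuous (fun y => dotp (f y) (g y))}.
Proof.
move=> cf cg; apply: cvgD; apply: cvgM.
- exact: (cvg_comp _ _ cf cvg_fst).
- exact: (cvg_comp _ _ cg cvg_fst).
- exact: (cvg_comp _ _ cf cvg_snd).
- exact: (cvg_comp _ _ cg cvg_snd).
Qed.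

Lemma continuous_crossp (T : topologicalType) (f g : T -> R * R) x :
  {for x, continuous f} -> {for x, continuous g} ->
  {for x, continuous (fun y => crossp (f y) (g y))}.
Proof.
move=> cf cg; apply: cvgB; apply: cvgM.
- exact: (cvg_comp _ _ cf cvg_fst).
- exact: (cvg_comp _ _ cg cvg_snd).
- exact: (cvg_comp _ _ cf cvg_snd).
- exact: (cvg_comp _ _ cg cvg_fst).
Qed.

Lemma continuous_angle_step (T : topologicalType) (s : T -> R)
    (f g : T -> R * R) x :
  {for x, continuous s} -> {for x, continuous f} -> {for x, continuous g} ->
  0 < dotp (f x) (g x) ->
  {for x, continuous (fun y =>
    s y + atan (crossp (f y) (g y) / dotp (f y) (g y)))}.
Proof.
move=> cs cf cg fg0; apply: cvgD; first exact: cs.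
apply: (@continuous_comp _ _ _ (fun y => crossp (f y) (g y) / dotp (f y) (g y)));
  last exact: continuous_atan.
apply: cvgM; first exact: continuous_crossp.
by apply: cvgV; [rewrite gt_eqF | exact: continuous_dotp].
Qed.

(** The dot product is positive on the diagonal over [K]; continuity keeps it so nearby, and
    compactness makes one radius serve all of [K]. *)
Lemma uniform_dotp_gt0 F K : continuous F -> compact K ->
  (forall z, K z -> F z != 0) ->
  exists2 d : R, 0 < d &
    forall x y : R * R, K x -> `|x - y| < d -> 0 < dotp (F x) (F y).
Proof.
move=> cF /compact_near_coveringP cK F0.
have := cK R (0 : R)^'+
  (fun d x => forall y, `|x - y| < d -> 0 < dotp (F x) (F y)) _.
case=> [x Kx|e /= e0 He].
  have c1 : {for (x, x), continuous (fun p => dotp (F p.1) (F p.2))}.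
    apply: continuous_dotp.
      by apply: (@continuous_comp _ _ _ fst F); [exact: cvg_fst|exact: cF].
    by apply: (@continuous_comp _ _ _ snd F); [exact: cvg_snd|exact: cF].
  have /nbhs_ballP[e /= e0 He] : \forall p \near (x, x), 0 < dotp (F p.1) (F p.2).
    by apply: (cvgr_gt _ c1) => /=; exact/dotp_gt0/F0.
  (* Half of the radius, since [y] is close to [x'], which is itself close to [x]. *)
  have e20 : 0 < e / 2 by rewrite divr_gt0.
  exists (ball x (e / 2), [set d : R | d < e / 2]).
    split; first exact: nbhsx_ballx.
    exact: nbhs_right_lt.
  move=> [x' d] /= [xx' de] y x'y; apply: (He (x', y)); split => /=.
    by apply: le_ball xx'; lra.
  rewrite -ball_normE /= in xx' *; rewrite -(subrK x' x) -addrA.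
  apply: le_lt_trans (ler_normD _ _) _; lra.
exists (e / 2) => [|x y Kx xy]; first by rewrite divr_gt0.
apply: (He (e / 2)) => //=; last by rewrite divr_gt0.
by rewrite sub0r normrN gtr0_norm ?divr_gt0//; lra.
Qed.

(* The steps of this sum are small enough for atan to be the exact angle
   between consecutive vectors, so the lift is an explicit continuous
   expression. *)
Fixpoint ray_angle (a : R) F (h : R) (n : nat) (z : R * R) : R :=
  if n is k.+1 then
    let u := F ((k%:R * h) *: z) in let v := F ((k.+1%:R * h) *: z) in
    ray_angle a F h k z + atan (crossp u v / dotp u v)
  else a.

(** Every point of [K] is reached from 0 along its ray. As [K] is bounded, one number of steps is
    fine enough for all rays, so the angle carried along them is continuous in the endpoint. *)
Lemma angle_lift F K : continuous F -> compact K ->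
  (forall z (t : R), K z -> 0 <= t <= 1 -> K (t *: z)) ->
  (forall z, K z -> F z != 0) ->
  exists phi : R * R -> R, forall z, K z ->
    {for z, continuous phi} /\ has_angle (phi z) (F z).
Proof.
move=> cF cK starK F0.
(* A star-shaped set missing 0 is empty, and then any [phi] will do. *)
have [K0|nK0] := pselect (K 0); last first.
  exists (fun=> 0) => z Kz; case: nK0; rewrite -(scale0r z).
  by apply: starK => //; rewrite lexx ler01.
have [d d0 Hd] := uniform_dotp_gt0 cF cK F0.
have [M [_ HM]] := compact_bounded cK.
have [M' M'0 {}HM] : exists2 M' : R, 0 < M' & forall z, K z -> `|z| <= M'.
  exists (`|M| + 1); first by rewrite ltr_pwDr.
  by move=> z Kz; apply: (HM _ _ z Kz); rewrite (le_lt_trans (ler_norm M))// ltrDl.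
have [a ha] := has_angle_exists (F0 _ K0).
pose N := (Num.truncn (M' / d)).+1.
have N0 : (0 : R) < N%:R by rewrite ltr0n.
have dN : M' / N%:R < d.
  rewrite ltr_pdivrMr// mulrC -ltr_pdivrMr//.
  by rewrite truncnS_gt.
pose h : R := N%:R^-1.
have h0 : 0 < h by rewrite invr_gt0.
have tK n z : K z -> (n <= N)%N -> K ((n%:R * h) *: z).
  move=> Kz nN; apply: starK => //; rewrite mulr_ge0 ?(ltW h0)//=.
  by rewrite ler_pdivrMr// mul1r ler_nat.
have pos n z : K z -> (n < N)%N ->
    0 < dotp (F ((n%:R * h) *: z)) (F ((n.+1%:R * h) *: z)).
  move=> Kz nN; apply: Hd; first by apply: tK => //; exact: ltnW.
  rewrite -scalerBl -mulrBl -natr1 opprD addNKr mulN1r normrZ normrN gtr0_norm//.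
  by rewrite mulrC (le_lt_trans _ dN)// ler_pM2r// HM.
have lift n z : K z -> (n <= N)%N ->
    {for z, continuous (ray_angle a F h n)} /\
    has_angle (ray_angle a F h n z) (F ((n%:R * h) *: z)).
  move=> Kz; elim: n => [_|n IH nN].
    by rewrite mul0r scale0r; split; [exact: cvg_cst|].
  have [IH1 IH2] := IH (ltnW nN); split; last exact: has_angle_step (pos _ _ Kz nN).
  have cs (t : R) : {for z, continuous (fun y : R * R => F (t *: y))}.
    apply: (@continuous_comp _ _ _ (fun y : R * R => t *: y) F); last exact: cF.
    exact: scaler_continuous.

  by apply: (continuous_angle_step IH1 (cs _) (cs _)); exact: pos.
exists (ray_angle a F h N) => z Kz.
have [l1 l2] := lift N z Kz (leqnn N); split => //.
by move: l2; rewrite divff ?scale1r// gt_eqF.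
Qed.

End AngleLift.

(** * Continuity of composites, sections and pairs *)

Lemma continuous_comp_within (T U V : topologicalType) (A : set U)
    (f : U -> V) (r : T -> U) :
  {within A, continuous f} -> continuous r -> (forall x, A (r x)) ->
  continuous (f \o r).
Proof.
move=> /subspace_continuousP cf cr rA x; apply: cvg_comp (cf _ (rA x)).
move=> W /= WA.
have : nbhs x [set y | A (r y) -> W (r y)] := cr x _ WA.
by apply: filterS => y /= /(_ (rA y)).
Qed.

(** On a compact set, an injective continuous map to a Hausdorff space is a homeomorphism onto its
    image: the image of the part of [K] outside an open [W'] is closed and misses [f (g t)]. *)
Lemma continuous_section_compact (T U V : topologicalType) (K : set U)
    (f : U -> V) (g : T -> U) :
  hausdorff_space V -> compact K -> continuous f -> {in K &, injective f} ->
  (forall t, K (g t)) -> continuous (f \o g) -> continuous g.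
Proof.
move=> hV cK cf injf gK cfg t W; rewrite /= nbhsE => -[W' [oW' W't] W'W].
have cl : closed (f @` (K `&` ~` W')).
  apply: compact_closed => //; apply: continuous_compact.
    exact: continuous_subspaceT.
  by apply: compact_closedI => //; exact: open_closedC.
have : nbhs ((f \o g) t) (~` (f @` (K `&` ~` W'))).
  apply: open_nbhs_nbhs; split; first exact: closed_openC.
  move=> [z [Kz nz]] fz; apply: nz.
  by rewrite (injf z (g t) _ _ fz) ?inE.
move=> nb; have : nbhs t [set s | ~ (f @` (K `&` ~` W')) (f (g s))] := cfg t _ nb.
apply: filterS => s /= ns; apply: W'W.
by apply: contrapT => nW; apply: ns; exists (g s).
Qed.

Lemma continuous_pair (T U V : topologicalType) (f : T -> U) (g : T -> V) :
  continuous f -> continuous g -> continuous (fun x => (f x, g x)).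
Proof.
move=> cf cg x.
exact: (@cvg_pair _ _ _ (nbhs x) (nbhs (f x)) (nbhs (g x)) _ _ _ f g (cf x) (cg x)).
Qed.

(** * Turning of a path around a point *)

Section Turning.
Variable R : realType.
Implicit Types (c : R -> R * R) (p : R * R).

(** A relation, because a lift is only known to exist; by [turning_uniq] the value does not depend
    on the lift. *)
Definition turning c (d : R) := exists phi : R -> R,
  (forall t, 0 <= t <= 1 -> {for t, continuous phi} /\ has_angle (phi t) (c t))
  /\ d = phi 1 - phi 0.

Lemma turning_opp c d : turning c d -> turning (fun t => - c t) d.
Proof.
move=> [phi [Hphi ->]]; exists (fun t => phi t + pi); split; last by ring.
move=> t /Hphi[cphi aphi]; split; last exact: has_angle_addpi.
by apply: cvgD => //; exact: cvg_cst.
Qed.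

(** The difference of two lifts has cosine 1 throughout, so it cannot rise. The hypotheses are
    symmetric, hence the inequality already gives uniqueness. *)
Lemma turning_le c d d' : turning c d -> turning c d' -> d <= d'.
Proof.
move=> [phi [Hphi ->]] [psi [Hpsi ->]]; rewrite leNgt; apply/negP => lt_d.
pose g t := phi t - psi t.
have cg t : 0 <= t <= 1 -> cos (g t) = 1.
  by move=> t01; apply: (has_angle_uniq (Hphi t t01).2 (Hpsi t t01).2).
have g01 : g 0 < g 1 by rewrite /g; lra.
(* A rise in (0, pi], where the cosine is below 1, small enough for the intermediate value theorem
   to make [g] attain it. *)
pose e := Num.min (pi : R) (g 1 - g 0).
have e0 : 0 < e by rewrite lt_min pi_gt0 subr_gt0.
have epi : e <= pi by rewrite ge_min lexx.
have eg : e <= g 1 - g 0 by rewrite ge_min lexx orbT.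
have [t t01 gt] : exists2 t, t \in `[0, 1] & g t = g 0 + e.
  apply: IVT => //; last first.
    by rewrite min_l ?max_r ?(ltW g01)//; apply/andP; split; lra.
  apply: continuous_in_subspaceT => x; rewrite inE /= in_itv /= => x01.
  by apply: cvgB; [exact: (Hphi x x01).1|exact: (Hpsi x x01).1].
rewrite in_itv /= in t01.
have := cg t t01; rewrite gt cosD.
have c0 : cos (g 0) = 1 by apply: cg; rewrite lexx ler01.
have -> : sin (g 0) = 0 by apply: cos1sin0; rewrite c0 normr1.
rewrite c0 mul1r mul0r subr0 => ce.
have := @cos_lt1 R e; rewrite e0 epi ce ltxx => /(_ isT); exact.
Qed.

Lemma turning_uniq c d d' : turning c d -> turning c d' -> d = d'.
Proof. by move=> h h'; apply: le_anti; rewrite !(@turning_le c). Qed.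

Lemma turning_int c d a b : turning c d ->
  has_angle a (c 0) -> has_angle b (c 1) ->
  exists n : int, d = b - a + n%:~R * (pi *+ 2).
Proof.
move=> [phi [Hphi ->]] ha hb.
have [|_ h0] := Hphi 0; first by rewrite lexx ler01.
have [|_ h1] := Hphi 1; first by rewrite lexx ler01.
have [n0 e0] := cos_eq1_int (has_angle_uniq h0 ha).
have [n1 e1] := cos_eq1_int (has_angle_uniq h1 hb).
exists (n1 - n0); rewrite intrD rmorphN /= mulrDl mulNr -e0 -e1; ring.
Qed.

Lemma turning_lift (F : R * R -> R * R) (K : set (R * R)) (phi : R * R -> R) c :
  (forall z, K z -> {for z, continuous phi} /\ has_angle (phi z) (F z)) ->
  continuous c -> (forall t, 0 <= t <= 1 -> K (c t)) ->
  turning (F \o c) (phi (c 1) - phi (c 0)).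
Proof.
move=> Hphi cc cK; exists (phi \o c); split => // t /cK/Hphi[cphi aphi].
by split => //; apply: continuous_comp; [exact: cc|exact: cphi].
Qed.

(* The map (s, t) |-> c s - e t lifts to an angle on the whole unit square,
   and the two monotone boundary paths from (0, 0) to (1, 1) turn equally. *)
Lemma turning_disjoint c e d0 d1 d2 d3 : continuous c -> continuous e ->
  (forall s t, c s != e t) ->
  turning (fun s => c s - e 0) d0 -> turning (fun t => e t - c 1) d1 ->
  turning (fun t => e t - c 0) d2 -> turning (fun s => c s - e 1) d3 ->
  d0 + d1 = d2 + d3.
Proof.
move=> cc ce dis h0 h1 h2 h3.
pose F (z : R * R) := c z.1 - e z.2.
(* The square is star-shaped about its corner 0, as [angle_lift] requires. *)
pose K : set (R * R) := `[0, 1] `*` `[0, 1].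
have cF : continuous F.
  move=> z; apply: cvgB.
    by apply: (@continuous_comp _ _ _ fst c); [exact: cvg_fst|exact: cc].
  by apply: (@continuous_comp _ _ _ snd e); [exact: cvg_snd|exact: ce].
have cK : compact K by apply: compact_setX; exact: segment_compact.
have [|z _|phi Hphi] := @angle_lift R F K cF cK.
- move=> [x y] t [/= ]; rewrite !in_itv /= => /andP[x0 x1] /andP[y0 y1].
  move=> /andP[t0 t1]; split; rewrite /= in_itv /= /GRing.scale /= mulr_ge0//=;
    exact: mulr_ile1.
- by rewrite subr_eq0.
have ch (y : R) : continuous (fun s : R => (s, y)).
  apply: (@continuous_pair _ _ _ (fun s : R => s) (fun _ : R => y)) => s;
    [exact: cvg_id|exact: cvg_cst].
have cv (x : R) : continuous (fun t : R => (x, t)).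
  apply: (@continuous_pair _ _ _ (fun _ : R => x) (fun t : R => t)) => s;
    [exact: cvg_cst|exact: cvg_id].
have u0 : (0 : R) \in `[0, 1] by rewrite in_itv /= lexx ler01.
have u1 : (1 : R) \in `[0, 1] by rewrite in_itv /= lexx ler01.
have k0 : turning (fun s => c s - e 0) (phi (1, 0) - phi (0, 0)).
  by apply: (turning_lift Hphi (ch 0)) => t t01; split; rewrite /= ?in_itv.
have k3 : turning (fun s => c s - e 1) (phi (1, 1) - phi (0, 1)).
  by apply: (turning_lift Hphi (ch 1)) => t t01; split; rewrite /= ?in_itv.
have k1 : turning (fun t => e t - c 1) (phi (1, 1) - phi (1, 0)).
  have -> : (fun t => e t - c 1) = (fun t => - (F \o (fun t => (1, t))) t).
    by apply/funext => t; rewrite /F /= opprB.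
  by apply/turning_opp/(turning_lift Hphi (cv 1)) => t t01; split; rewrite /= ?in_itv.
have k2 : turning (fun t => e t - c 0) (phi (0, 1) - phi (0, 0)).
  have -> : (fun t => e t - c 0) = (fun t => - (F \o (fun t => (0, t))) t).
    by apply/funext => t; rewrite /F /= opprB.
  by apply/turning_opp/(turning_lift Hphi (cv 0)) => t t01; split; rewrite /= ?in_itv.
rewrite (turning_uniq h0 k0) (turning_uniq h1 k1).
by rewrite (turning_uniq h2 k2) (turning_uniq h3 k3); ring.
Qed.

Lemma turning_exists c p : continuous c -> (forall t, c t != p) ->
  exists d, turning (fun t => c t - p) d.
Proof.
move=> cc cp.
(* A segment starting at 0 stands for the parameter interval, since [angle_lift] works over the
   plane. *)
pose K : set (R * R) := `[0, 1] `*` [set 0].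
pose F (z : R * R) := c z.1 - p.
have cF : continuous F.
  move=> z; apply: cvgB; last exact: cvg_cst.
  by apply: (@continuous_comp _ _ _ fst c); [exact: cvg_fst|exact: cc].
have cK : compact K.
  by apply: compact_setX; [exact: segment_compact|exact: compact_set1].
have [|z _|phi Hphi] := @angle_lift R F K cF cK.
- move=> [x y] t [/= ]; rewrite !in_itv /= => /andP[x0 x1] -> /andP[t0 t1].
  split; rewrite /= ?in_itv /= /GRing.scale /= ?mulr0// mulr_ge0//=.
  exact: mulr_ile1.
- by rewrite subr_eq0.
exists (phi (1, 0) - phi (0, 0)).
apply: (@turning_lift F K phi (fun t => (t, 0)) Hphi).
  apply: (@continuous_pair _ _ _ (fun s : R => s) (fun _ : R => 0 : R)) => s;
    [exact: cvg_id|exact: cvg_cst].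
by move=> t t01; split; rewrite /= ?in_itv.
Qed.

(** Dividing by the squared norm avoids a square root: a point outside the disc goes to its inverse
    in the unit circle, which lies in the disc. *)
Definition disc_retraction (z : R * R) : R * R :=
  (Num.max 1 (dotp z z))^-1 *: z.

Lemma unit_discE (z : R * R) : unit_disc z = (dotp z z <= 1).
Proof. by rewrite /unit_disc /dotp /= -!expr2. Qed.

Lemma disc_retraction_continuous : continuous disc_retraction.
Proof.
move=> z; apply: (@cvgZ _ _ _ (nbhs z)); last exact: cvg_id.
apply: cvgV; first by rewrite gt_eqF// lt_max ltr01.
have cd : {for z, continuous (fun y : R * R => dotp y y)}.
  by apply: continuous_dotp; exact: cvg_id.
apply: (@continuous_max _ _ (fun=> 1) (fun y : R * R => dotp y y)) => //.
exact: cvg_cst.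
Qed.

Lemma disc_retraction_disc z : unit_disc (disc_retraction z).
Proof.
rewrite unit_discE /disc_retraction; set m := Num.max _ _.
have m1 : 1 <= m by rewrite le_max lexx.
have mz : dotp z z <= m by rewrite le_max lexx orbT.
have m0 : 0 < m by rewrite (lt_le_trans ltr01).
have -> : dotp (m^-1 *: z) (m^-1 *: z) = m^-1 ^+ 2 * dotp z z.
  by rewrite /dotp /GRing.scale /= /GRing.scale /=; ring.
rewrite exprVn mulrC ler_pdivrMr ?exprn_gt0// mul1r (le_trans mz)//.
by rewrite expr2 ler_peMr// ltW.
Qed.

Lemma disc_retraction_id z : unit_disc z -> disc_retraction z = z.
Proof.
by rewrite unit_discE /disc_retraction => z1; rewrite max_l// invr1 scale1r.
Qed.

Lemma unit_disc_compact : compact (@unit_disc R).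
Proof.
have cK : compact (`[-1, 1] `*` `[-1, 1] : set (R * R)).
  by apply: compact_setX; exact: segment_compact.
apply: subclosed_compact cK _ => [|z].
  have -> : @unit_disc R = (fun z => dotp z z) @^-1` [set x | x <= 1].
    by apply/funext => z; rewrite unit_discE.
  apply: closed_comp; last exact: closed_le.
  by move=> z _; apply: continuous_dotp; exact: cvg_id.
rewrite unit_discE /dotp -!expr2 => z1.
by split; rewrite /= in_itv /= -ler_norml -(@expr_le1 _ 2)// real_normK ?num_real//;
  apply: le_trans z1; rewrite ?lerDl ?lerDr sqr_ge0.
Qed.

(** The angle around [p] lifts over the whole disc and is carried to [D] by the inverse of the
    parametrization. As [Phi] does not depend on [c], turnings along a closed chain of paths in [D]
    add up to 0. *)
Lemma turning_closed_region (D : set (R * R)) p :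
  simple_closed_region D -> ~ D p -> exists Phi : R * R -> R,
  forall c, continuous c -> (forall t, D (c t)) ->
    turning (fun t => c t - p) (Phi (c 1) - Phi (c 0)).
Proof.
move=> [f [cf injf DE]] nDp.
pose h := f \o disc_retraction.
have hE z : unit_disc z -> h z = f z by move=> uz; rewrite /h /= disc_retraction_id.
have ch : continuous h.
  apply: continuous_comp_within cf disc_retraction_continuous _.
  exact: disc_retraction_disc.
have [| |z uz|phi Hphi] := @angle_lift R (fun z => h z - p) _ _ unit_disc_compact.
- by move=> z; apply: cvgB; [exact: ch|exact: cvg_cst].
- move=> z t; rewrite !unit_discE => z1 /andP[t0 t1].
  have -> : dotp (t *: z) (t *: z) = t ^+ 2 * dotp z z.
    by rewrite /dotp /GRing.scale /= /GRing.scale /=; ring.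
  apply: mulr_ile1 => //; rewrite ?exprn_ile1 ?sqr_ge0//.
  by rewrite addr_ge0// -expr2 sqr_ge0.
- rewrite subr_eq0; apply/eqP => hp; apply: nDp.
  by rewrite DE -hp hE//; exists z.
have /choice[inv Hinv] : forall q : R * R, exists z : R * R, D q -> unit_disc z /\ f z = q.
  move=> q; have [Dq|nDq] := pselect (D q); last by exists 0.
  by move: (Dq); rewrite DE => -[z uz fz]; exists z.
exists (phi \o inv) => c cc cD.
have invD t : unit_disc (inv (c t)) := (Hinv _ (cD t)).1.
have hinv t : h (inv (c t)) = c t by rewrite hE// (Hinv _ (cD t)).2.
pose g : R -> R * R := inv \o c.
(* [inv] is merely a choice of preimages; its continuity along [c] comes from compactness of the
   disc. *)
have cinv : continuous g.
  apply: (@continuous_section_compact _ _ _ (@unit_disc R) h g) => //.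
  - exact: unit_disc_compact.
  - by move=> x y; rewrite !inE => ux uy; rewrite !hE// => /injf; apply; rewrite inE.
  - by rewrite (_ : h \o _ = c)//; apply/funext => t; exact: hinv.
have := turning_lift Hphi cinv (fun t _ => invD t).
by congr turning; apply/funext => t; rewrite /= hinv.
Qed.

End Turning.

(** * The parity obstruction for K5 minus an edge *)

Definition k5_minus_edge : rel nat :=
  [rel i j | (i < j < 5)%N && ~~ ((i == 3%N) && (j == 4%N))].

(* Order the vertices by index.  For independent edges ij and kl, the turning
   of ij around k and l balances that of kl around i and j; modulo full turns
   this leaves the indicator of the interleaving of {i,j} and {k,l}, and the
   number of interleaved pairs is odd.  Every other term occurs twice, apart
   from those of the triangle 012 around 3 and 4. *)
Lemma k5_minus_edge_closed_region (R : realType) (p : nat -> R * R)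
    (c : nat -> nat -> R -> R * R) (D : set (R * R)) :
  (forall i j, (i < 5)%N -> (j < 5)%N -> i != j -> p i != p j) ->
  (forall i j, k5_minus_edge i j ->
    [/\ continuous (c i j), c i j 0 = p i & c i j 1 = p j]) ->
  (forall i j k t, k5_minus_edge i j -> (k < 5)%N -> k != i -> k != j ->
    c i j t != p k) ->
  (forall i j k l s t, k5_minus_edge i j -> k5_minus_edge k l ->
    [&& i != k, i != l, j != k & j != l] -> c i j s != c k l t) ->
  simple_closed_region D -> ~ D (p 3%N) -> ~ D (p 4%N) ->
  (forall t, D (c 0%N 1%N t)) -> (forall t, D (c 1%N 2%N t)) ->
  (forall t, D (c 0%N 2%N t)) -> False.
Proof.
move=> injp carc cvtx cdis scD nD3 nD4 D01 D12 D02.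
have /choice[a Ha] : forall ij : nat * nat, exists a,
    (ij.1 < 5)%N -> (ij.2 < 5)%N -> ij.1 != ij.2 -> has_angle a (p ij.2 - p ij.1).
  move=> [i j] /=; have [ij|ij] := eqVneq (p j) (p i).
    exists 0 => i5 j5 ne; have := injp i j i5 j5 ne.
    by rewrite ij eqxx.
  have [|b hb] := @has_angle_exists _ (p j - p i); first by rewrite subr_eq0.
  by exists b.
(* The direction is chosen freely for [i < j] and its reverse is set to differ by exactly pi, so
   that [al i j - al j i] has a sign read off the order. *)
pose al i j := if (i < j)%N then a (i, j) else a (j, i) + pi.
have Hal i j : (i < 5)%N -> (j < 5)%N -> i != j -> has_angle (al i j) (p j - p i).
  move=> i5 j5 ij; rewrite /al; case: ifP => _; first exact: (Ha (i, j)).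
  by rewrite -opprB; apply/has_angle_addpi/(Ha (j, i)) => //=; rewrite eq_sym.
have alC i j : i != j ->
    al i j - al j i = (if (i < j)%N then - 1 else 1 : int)%:~R * pi.
  by rewrite /al; case: ltngtP => //= _ _; rewrite ?rmorphN /=; ring.
(* [n] counts the full turns of the path [ij] around [k] in excess of the chosen directions. *)
have /choice[n Hn] : forall ijk : nat * nat * nat, exists n : int,
    let: (i, j, k) := ijk in
    k5_minus_edge i j -> (k < 5)%N -> k != i -> k != j ->
    turning (fun t => c i j t - p k) (al k j - al k i + n%:~R * (pi *+ 2)).
  move=> [[i j] k]; have [E|nE] := boolP [&& k5_minus_edge i j, (k < 5)%N, k != i & k != j];
    last first.
    by exists 0 => E k5 ki kj; rewrite E k5 ki kj in nE.
  case/and4P: E => E k5 ki kj.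
  have [cc c0 c1] := carc i j E.
  have [i5 j5] : (i < 5)%N /\ (j < 5)%N by move: E; rewrite /k5_minus_edge /=; lia.
  have [d Hd] := turning_exists cc (fun t => cvtx i j k t E k5 ki kj).
  have [||m dE] := @turning_int _ _ _ (al k i) (al k j) Hd.
  - by rewrite c0; apply: Hal.
  - by rewrite c1; apply: Hal.
  by exists m => _ _ _ _; rewrite -dE.
pose s i j : int := if (i < j)%N then - 1 else 1.
pose N i j k := n (i, j, k).
have pi0 : pi != 0 :> R by rewrite gt_eqF// pi_gt0.
(* The four turnings of an independent pair, divided by pi: each direction meets its reverse, which
   leaves the signs [s]. *)
have pair i j k l : k5_minus_edge i j -> k5_minus_edge k l ->
    [&& i != k, i != l, j != k & j != l] ->
    s k j - s k i + s j l - s i l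
      + 2 * (N i j k + N k l j - N k l i - N i j l) = 0.
  move=> Eij Ekl ne; have [ccij c0 c1] := carc i j Eij.
  have [cckl e0 e1] := carc k l Ekl.
  have := ne; case/and4P => ik il jk jl.
  have [[i5 j5] [k5 l5]] : ((i < 5) /\ (j < 5))%N /\ ((k < 5) /\ (l < 5))%N.
    by move: Eij Ekl; rewrite /k5_minus_edge /=; lia.
  have h0 := Hn (i, j, k) Eij k5; have h1 := Hn (k, l, j) Ekl j5.
  have h2 := Hn (k, l, i) Ekl i5; have h3 := Hn (i, j, l) Eij l5.
  have := @turning_disjoint R (c i j) (c k l) _ _ _ _ ccij cckl
    (fun s t => cdis i j k l s t Eij Ekl ne).
  rewrite e0 e1 c0 c1 => /(_ _ _ _ _ (h0 _ _) (h1 _ _) (h2 _ _) (h3 _ _)).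
  rewrite ![_ == i]eq_sym ![_ == j]eq_sym ik il jk jl.
  rewrite [j == k]eq_sym in jk; rewrite [i == k]eq_sym in ik.
  move=> /(_ isT isT isT isT isT isT isT isT) eqd.
  apply: (@intr_inj R); apply: (mulIf pi0).
  have := alC k j jk; have := alC k i ik; have := alC j l jl; have := alC i l il.
  rewrite !(rmorphD, rmorphB, rmorphM, rmorphN) /= -/(s k j) -/(s k i) -/(s j l) -/(s i l).
  rewrite mul0r -/(N i j k) -/(N k l j) -/(N k l i) -/(N i j l) in eqd *.
  by move=> *; lra.
(* The chosen directions cancel around the triangle, and its total turning around a point off the
   disc is 0, so the full turns cancel too. *)
have tri q : q = 3%N \/ q = 4%N -> ~ D (p q) -> N 0%N 1%N q + N 1%N 2%N q = N 0%N 2%N q.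
  move=> q34 nDq; have [Phi HPhi] := turning_closed_region scD nDq.
  have [c01 s01 t01] := carc 0%N 1%N isT.
  have [c12 s12 t12] := carc 1%N 2%N isT.
  have [c02 s02 t02] := carc 0%N 2%N isT.
  have := HPhi _ c01 D01; have := HPhi _ c12 D12; have := HPhi _ c02 D02.
  rewrite s01 t01 s12 t12 s02 t02 => k02 k12 k01.
  have [q5 [q0 [q1 q2]]] : (q < 5 /\ q != 0 /\ q != 1 /\ q != 2)%N by lia.
  have e01 := turning_uniq k01 (Hn (0%N, 1%N, q) isT q5 q0 q1).
  have e12 := turning_uniq k12 (Hn (1%N, 2%N, q) isT q5 q1 q2).
  have e02 := turning_uniq k02 (Hn (0%N, 2%N, q) isT q5 q0 q2).
  apply: (@intr_inj R); apply: (mulIf pi0); rewrite rmorphD /= /N; lra.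
have := tri _ (or_introl erefl) nD3; have := tri _ (or_intror erefl) nD4.
(* The twelve independent pairs. Five of them interleave, one for each set of four vertices; that
   five is odd gives the contradiction. *)
have := pair 0%N 1%N 2%N 3%N isT isT isT; have := pair 0%N 1%N 2%N 4%N isT isT isT.
have := pair 0%N 2%N 1%N 3%N isT isT isT; have := pair 0%N 2%N 1%N 4%N isT isT isT.
have := pair 0%N 3%N 1%N 2%N isT isT isT; have := pair 0%N 3%N 1%N 4%N isT isT isT.
have := pair 0%N 3%N 2%N 4%N isT isT isT; have := pair 0%N 4%N 1%N 2%N isT isT isT.
have := pair 0%N 4%N 1%N 3%N isT isT isT; have := pair 0%N 4%N 2%N 3%N isT isT isT.
have := pair 1%N 3%N 2%N 4%N isT isT isT; have := pair 1%N 4%N 2%N 3%N isT isT isT.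
rewrite /s /=; lia.
Qed.

(** * Arcs of edges and boundaries of regions *)

Section Drawings.
Variable R : realType.

Definition clamp (t : R) : R := Num.max 0 (Num.min t 1).

Lemma clamp_continuous : continuous clamp.
Proof.
move=> t; have c1 : {for t, continuous (fun s : R => Num.min s 1)}.
  by apply: (@continuous_min R R (fun s => s) (fun=> 1)); [exact: cvg_id|exact: cvg_cst].
apply: (@continuous_max R R (fun=> 0) (fun s => Num.min s 1)) => //.
exact: cvg_cst.
Qed.

Lemma clamp01 t : 0 <= clamp t <= 1.
Proof. by rewrite /clamp le_max lexx ge_max ler01 ge_min lexx orbT. Qed.

Lemma clamp_id t : 0 <= t <= 1 -> clamp t = t.
Proof. by move=> /andP[t0 t1]; rewrite /clamp min_l// max_r. Qed.

Lemma continuous_clamp (g : R -> R * R) :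
  {within `[0, 1], continuous g} -> continuous (g \o clamp).
Proof.
move=> cg; apply: (@continuous_comp_within _ _ _ _ g clamp cg clamp_continuous).
by move=> s /=; rewrite in_itv /= clamp01.
Qed.

Lemma closed_simple_closed_region (A : set (R * R)) :
  simple_closed_region A -> closed A.
Proof.
move=> [f [cf _ ->]]; apply: compact_closed => //.
by apply: continuous_compact => //; exact: unit_disc_compact.
Qed.

(** Along a path missing the boundary, the preimages of the interior and of the closure of [A]
    agree, hence form a clopen subset of a connected segment. *)
Lemma path_meets_boundary (c : R -> R * R) (A : set (R * R)) a b :
  continuous c -> a <= b -> A (c a) <-> ~ A (c b) ->
  exists2 t, a <= t <= b & boundary A (c t).
Proof.
move=> cc ab AaAb; apply: contrapT => nb.
have nbt t : a <= t <= b -> closure A (c t) -> interior A (c t).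
  by move=> tab cl; apply: contrapT => ni; apply: nb; exists t.
have AiA : interior A `<=` A by exact: interior_subset.
have AcA : A `<=` closure A by exact: subset_closure.
have sc : connected [set` `[a, b]] by exact: segment_connected.
have aab : a <= a <= b by rewrite lexx ab.
have bab : a <= b <= b by rewrite lexx ab.
pose B := [set` `[a, b]] `&` (c @^-1` interior A).
have BE : B = [set` `[a, b]] `&` (c @^-1` closure A).
  apply/seteqP; split=> t [tab] At; split=> //; first exact/AcA/AiA.
  by apply: nbt => //; move: tab; rewrite /= in_itv.
have B0 : B !=set0.
  have [Aa|nAa] := pselect (A (c a)).
    by exists a; split; [rewrite /= in_itv|apply: nbt => //; exact: AcA].
  have Ab : A (c b) by apply: contrapT => /AaAb.
  by exists b; split; [rewrite /= in_itv|apply: nbt => //; exact: AcA].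
have BT : B = [set` `[a, b]].
  apply: sc => //.
    exists (c @^-1` interior A) => //.
    by apply: open_comp; [move=> ? _; exact: cc|exact: open_interior].
  exists (c @^-1` closure A) => //.
  by apply: closed_comp; [move=> ? _; exact: cc|exact: closed_closure].
have allA t : a <= t <= b -> A (c t).
  by move=> tab; have [_ /AiA] : B t by rewrite BT /= in_itv.
by have /AaAb := allA a aab; apply; exact: allA.
Qed.

Lemma card_eq_two (T : choiceType) (X : set T) (k : nat) (x y : T) :
  (X #= `I_k)%card -> X x -> X y -> x <> y -> (2 <= k)%N.
Proof.
move=> /card_set_bijP[f [fI finj _]] Xx Xy xy.
have fx : (f x < k)%N := fI x Xx.
have fy : (f y < k)%N := fI y Xy.
rewrite leqNgt; apply/negP => k2; apply: xy; apply: finj; rewrite ?inE//.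
by lia.
Qed.

(** The boundary is met once before [t] and once after. Both points are interior to the arc because
    its ends are off the boundary, and they are distinct because [A] is closed, so [g t] is off the
    boundary as well. *)
Lemma arc_leaving_region (g : R -> R * R) (A : set (R * R)) (k : nat) t :
  simple_arc g -> closed A ->
  A (g 0) -> A (g 1) -> ~ boundary A (g 0) -> ~ boundary A (g 1) ->
  0 <= t <= 1 -> ~ A (g t) ->
  (open_curve g `&` boundary A #= `I_k)%card -> (2 <= k)%N.
Proof.
move=> [cg injg] clA A0 A1 nb0 nb1 t01 nAt Xk.
pose c := g \o clamp.
have cc : continuous c := continuous_clamp cg.
have ce s : 0 <= s <= 1 -> c s = g s by move=> s01; rewrite /c /= clamp_id.
have z01 : 0 <= (0 : R) <= 1 by rewrite lexx ler01.
have o01 : 0 <= (1 : R) <= 1 by rewrite ler01 lexx.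
case/andP: (t01) => t0 t1.
have [|s1 /andP[s10 s1t] bs1] := @path_meets_boundary c A 0 t cc t0.
  by rewrite (ce _ z01) (ce _ t01); split => _; [exact: nAt|exact: A0].
have [|s2 /andP[s2t s21] bs2] := @path_meets_boundary c A t 1 cc t1.
  by rewrite (ce _ o01) (ce _ t01); split => [/nAt []|/(_ A1) []].
have s101 : 0 <= s1 <= 1 by rewrite s10 (le_trans s1t).
have s201 : 0 <= s2 <= 1 by rewrite s21 (le_trans t0).
rewrite (ce _ s101) in bs1; rewrite (ce _ s201) in bs2.
have nbt : ~ boundary A (g t) by move=> [/clA].
have ne01 s : 0 <= s <= 1 -> boundary A (g s) -> open_curve g (g s).
  move=> /andP[s0 s1'] bs; exists s; last by [].
  rewrite /= in_itv /= !lt_neqAle s0 s1' !andbT.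
  apply/andP; split; apply/eqP => sE; [apply: nb0|apply: nb1].
    by rewrite sE.
  by rewrite -sE.
apply: (card_eq_two Xk (x := g s1) (y := g s2)).
- exact: (conj (ne01 _ s101 bs1) bs1).
- exact: (conj (ne01 _ s201 bs2) bs2).
- move=> /injg; rewrite !in_itv /= => /(_ s101 s201) s12.
  have ts : t = s1 by apply: le_anti; rewrite s1t s12 s2t.
  by apply: nbt; rewrite ts.
Qed.

Variables (G : graph) (D : graph_drawing R G).

Lemma edge_exists (u v : vertex G) : adj u v ->
  exists e : edge G, val e = [set u; v]%SET.
Proof.
move=> uv; have ee : [set u; v]%SET \in edges G.
  by rewrite inE; apply/existsP; exists u; apply/existsP; exists v; rewrite uv eqxx.
by exists (exist (fun e => e \in edges G) _ ee).
Qed.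

Lemma edge_arc_point (e : edge G) (t : R) : 0 <= t <= 1 ->
  open_curve (edge_arc D e) (edge_arc D e t) \/
  exists2 u, u \in val e & edge_arc D e t = vertex_point D u.
Proof.
move=> /andP[t0 t1].
have endp s : s = 0 \/ s = 1 ->
    exists2 u, u \in val e & edge_arc D e s = vertex_point D u.
  move=> s01; have : [set edge_arc D e 0; edge_arc D e 1] (edge_arc D e s).
    by case: s01 => ->; [left|right].
  by rewrite edge_arc_ends => -[u ue <-]; exists u.
have [->|tn0] := eqVneq t 0; first by right; apply: endp; left.
have [->|tn1] := eqVneq t 1; first by right; apply: endp; right.
by left; exists t => //=; rewrite in_itv /= !lt_neqAle t0 t1 eq_sym tn0 tn1.
Qed.

Lemma edge_arc_notin (e : edge G) (t : R) (v : vertex G) : 0 <= t <= 1 -> v \notin val e ->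
  edge_arc D e t != vertex_point D v.
Proof.
move=> t01 ve; apply/eqP => E.
have [op|[u ue uE]] := edge_arc_point e t01.
  by apply: (@edge_arc_vertex _ _ D e v); rewrite -E.
by move: ve; rewrite -(@vertex_point_inj _ _ D u v) ?ue// -uE.
Qed.

Lemma edge_arc_disjoint (e f : edge G) (s t : R) : no_edge_edge_crossing D ->
  0 <= s <= 1 -> 0 <= t <= 1 -> (forall u, u \in val e -> u \notin val f) ->
  edge_arc D e s != edge_arc D f t.
Proof.
move=> ncr s01 t01 dis; apply/eqP => E.
have [op|[u ue uE]] := edge_arc_point e s01; last first.
  have uf : u \notin val f by exact: dis.
  by have := edge_arc_notin t01 uf; rewrite -E uE eqxx.
have [op'|[u uf uE]] := edge_arc_point f t01; last first.
  by apply: (@edge_arc_vertex _ _ D e u); rewrite -uE -E.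
have [ef|ef] := eqVneq e f.
  have [x xe] : exists x, x \in val e.
    have : val e \in edges G by exact: valP.
    rewrite inE => /existsP[x /existsP[y /andP[_ /eqP ->]]].
    by exists x; rewrite inE set11.
  by have := dis x xe; rewrite -ef xe.
have : (open_curve (edge_arc D e) `&` open_curve (edge_arc D f)) (edge_arc D e s).
  by split => //; rewrite E.
by rewrite ncr.
Qed.

(** The arc may start at either endpoint and is reversed when needed; clamping extends it to the
    whole line, as the turning lemmas ask. *)
Lemma edge_path (e : edge G) (u v : vertex G) : val e = [set u; v]%SET ->
  exists c : R -> R * R,
    [/\ continuous c, c 0 = vertex_point D u, c 1 = vertex_point D v &
        forall t, exists2 s, 0 <= s <= 1 & c t = edge_arc D e s].
Proof.
move=> eE; have [cg injg] := edge_arc_simple D e; set g := edge_arc D e in cg injg *.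
have z01 : 0 <= (0 : R) <= 1 by rewrite lexx ler01.
have o01 : 0 <= (1 : R) <= 1 by rewrite ler01 lexx.
have n01 : g 0 <> g 1.
  move=> /injg; rewrite !in_itv /= => /(_ z01 o01) /eqP.
  by rewrite eq_sym oner_eq0.
have ends : [set g 0; g 1] = vertex_point D @` [set w | w \in val e].
  exact: edge_arc_ends.
have cc : continuous (g \o clamp) := continuous_clamp cg.
have ce s : 0 <= s <= 1 -> (g \o clamp) s = g s by move=> s01; rewrite /= clamp_id.
have inuv w : w \in val e -> w = u \/ w = v.
  by rewrite eE !inE => /orP[] /eqP ->; [left|right].
have [w0 w0e g0] : exists2 w, w \in val e & g 0 = vertex_point D w.
  have : [set g 0; g 1] (g 0) by left.
  by rewrite ends => -[w we <-]; exists w.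
have [w1 w1e g1] : exists2 w, w \in val e & g 1 = vertex_point D w.
  have : [set g 0; g 1] (g 1) by right.
  by rewrite ends => -[w we <-]; exists w.
have w01 : w0 <> w1 by move=> w01; apply: n01; rewrite g0 g1 w01.
have [w0u|w0v] := inuv _ w0e.
  have w1v : w1 = v by have [w1u|//] := inuv _ w1e; case: w01; rewrite w0u w1u.
  exists (g \o clamp); split => //.
  - by rewrite ce// g0 w0u.
  - by rewrite ce// g1 w1v.
  - by move=> t; exists (clamp t) => //; exact: clamp01.
have w1u : w1 = u by have [//|w1v] := inuv _ w1e; case: w01; rewrite w0v w1v.
exists (fun t => (g \o clamp) (1 - t)); split.
- move=> t; apply: (@continuous_comp _ _ _ (fun t : R => 1 - t) (g \o clamp)); last exact: cc.
  by apply: cvgB; [exact: cvg_cst|exact: cvg_id].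
- by rewrite subr0 ce// g1 w1u.
- by rewrite subrr ce// g0 w0v.
- by move=> t; exists (clamp (1 - t)) => //; exact: clamp01.
Qed.

(** Otherwise the whole triangle opposite to the missing edge would lie in a disc avoiding both
    endpoints of that edge, which the parity obstruction excludes. *)
Lemma triangle_leaves_region (v : nat -> vertex G) (A : set (R * R)) :
  no_edge_edge_crossing D ->
  (forall i j, (i < 5)%N -> (j < 5)%N -> v i = v j -> i = j) ->
  (forall i j, k5_minus_edge i j -> adj (v i) (v j)) ->
  simple_closed_region A ->
  ~ A (vertex_point D (v 3%N)) -> ~ A (vertex_point D (v 4%N)) ->
  exists (i j : nat) (e : edge G) (t : R), [/\ (i < j < 3)%N,
    val e = [set v i; v j]%SET, 0 <= t <= 1 & ~ A (edge_arc D e t)].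
Proof.
move=> ncr injv adjv scA nA3 nA4; apply: contrapT => noexit.
have /choice[c Hc] : forall ij : nat * nat, exists c : R -> R * R,
    let: (i, j) := ij in k5_minus_edge i j ->
    exists2 e : edge G, val e = [set v i; v j]%SET &
    [/\ continuous c, c 0 = vertex_point D (v i), c 1 = vertex_point D (v j) &
        forall t, exists2 s, 0 <= s <= 1 & c t = edge_arc D e s].
  move=> [i j]; have [E|nE] := boolP (k5_minus_edge i j); last by exists (fun=> 0).
  have [e eE] := edge_exists (adjv i j E).
  by have [c cP] := edge_path eE; exists c => _; exists e.
have lt5 i j : k5_minus_edge i j -> (i < 5)%N /\ (j < 5)%N.
  by rewrite /k5_minus_edge /=; lia.
have vne i j : (i < 5)%N -> (j < 5)%N -> i != j -> v i != v j.
  by move=> i5 j5; apply: contra => /eqP /injv ->.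
have inA i j t : k5_minus_edge i j -> (i < j < 3)%N -> A (c (i, j) t).
  move=> E ij3; have [e eE [_ _ _ /(_ t)[s s01 ->]]] := Hc (i, j) E.
  by apply: contrapT => nA; apply: noexit; exists i, j, e, s.
apply: (@k5_minus_edge_closed_region R (vertex_point D \o v)
  (fun i j => c (i, j)) A) => //=.
- move=> i j i5 j5 ij; apply/eqP => /vertex_point_inj /injv E.
  by rewrite E// eqxx in ij.
- by move=> i j E; have [e _ []] := Hc (i, j) E.
- move=> i j k t E k5 ki kj; have [i5 j5] := lt5 i j E.
  have [e eE [_ _ _ /(_ t)[s s01 ->]]] := Hc (i, j) E.
  by apply: edge_arc_notin => //; rewrite eE !inE negb_or !vne.
- move=> i j k l s t Eij Ekl /and4P[ik il jk jl].
  have [[i5 j5] [k5 l5]] := (lt5 i j Eij, lt5 k l Ekl).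
  have [e eE [_ _ _ /(_ s)[s' s01 ->]]] := Hc (i, j) Eij.
  have [f fE [_ _ _ /(_ t)[t' t01 ->]]] := Hc (k, l) Ekl.
  apply: edge_arc_disjoint => //; rewrite eE fE.
  by move=> x; rewrite !inE => /orP[] /eqP ->; rewrite negb_or !vne.
- by move=> t; apply: inA.
- by move=> t; apply: inA.
- by move=> t; apply: inA.
Qed.

End Drawings.

(** * A straight-line drawing of one petal *)

Section StraightDrawing.
Variable R : realType.

(* A straight-line drawing of K5 minus the edge 34 with vertex 0 at the origin
   and everything else in the cone 0 <= y < x: 2 and 3 are the centroids of
   014 and 012. *)
Definition base_x (a : nat) : R := nth 0 [:: 0; 36; 24; 20; 36] a.
Definition base_y (a : nat) : R := nth 0 [:: 0; 0; 9; 3; 27] a.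

Definition base_seg (f : nat -> R) (a b : nat) (t : R) : R := f a + t * (f b - f a).

Definition k5_minus_edges : seq (nat * nat) :=
  [:: (0, 1); (0, 2); (0, 3); (0, 4); (1, 2); (1, 3); (1, 4); (2, 3); (2, 4)]%N.

Lemma k5_minus_edgesP a b : k5_minus_edge a b -> (a, b) \in k5_minus_edges.
Proof.
by move: a b => [|[|[|[|a]]]] [|[|[|[|[|b]]]]] //; rewrite /k5_minus_edge /=; lia.
Qed.

Ltac k5_cases H :=
  move/k5_minus_edgesP: H; rewrite !inE !xpair_eqE;
  repeat (case/orP; [|]); move=> /andP[/eqP -> /eqP ->]; rewrite /base_seg /base_x /base_y /=.

(** The ends are left out because the edges at vertex 0 start at the apex, which the cone
    excludes. *)
Lemma base_seg_cone a b (t : R) : k5_minus_edge a b -> 0 < t < 1 ->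
  0 <= base_seg base_y a b t < base_seg base_x a b t.
Proof.
by move=> E /andP[t0 t1]; k5_cases E; apply/andP; split; lra.
Qed.

Lemma base_seg_inj a b (s t : R) : k5_minus_edge a b ->
  base_seg base_x a b s = base_seg base_x a b t ->
  base_seg base_y a b s = base_seg base_y a b t -> s = t.
Proof. by move=> E; k5_cases E; lra. Qed.

Lemma base_seg_vertex a b c (t : R) : k5_minus_edge a b -> (c < 5)%N -> 0 < t < 1 ->
  base_seg base_x a b t = base_x c -> base_seg base_y a b t = base_y c -> False.
Proof.
move=> E c5 /andP[t0 t1]; move: c c5 => [|[|[|[|[|c]]]]] // _;
  k5_cases E; lra.
Qed.

Lemma base_seg_disjoint a b c d (s t : R) : k5_minus_edge a b -> k5_minus_edge c d ->
  0 < s < 1 -> 0 < t < 1 ->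
  base_seg base_x a b s = base_seg base_x c d t ->
  base_seg base_y a b s = base_seg base_y c d t -> (a, b) = (c, d).
Proof.
(* Eighty-one cases, each a linear system in [s] and [t] that is infeasible unless the two edges
   coincide. *)
move=> E F /andP[s0 s1] /andP[t0 t1]; k5_cases E; k5_cases F => h1 h2;
  solve [reflexivity | exfalso; lra].
Qed.
End StraightDrawing.

(** * The bouquet of petals *)

Section Bouquet.
Variable m : nat.

(* m copies of K5 minus an edge glued at the vertex None; the missing edges
   join the vertices 2 and 3 of 'I_4. *)
Definition bouquet_adj : rel (option ('I_m * 'I_4)) := fun u v =>
  match u, v with
  | None, None => false
  | Some (i, a), Some (j, b) => [&& i == j, a != b & ~~ ((1 < a) && (1 < b))%N]
  | _, _ => true
  end.

Lemma bouquet_adj_sym : symmetric bouquet_adj.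
Proof.
move=> [[i a]|] [[j b]|] //=.
by rewrite [i == j]eq_sym [a == b]eq_sym [(1 < a)%N && _]andbC.
Qed.

Lemma bouquet_adj_irr : irreflexive bouquet_adj.
Proof. by move=> [[i a]|] //=; rewrite !eqxx. Qed.

Definition bouquet : graph := Graph bouquet_adj_sym bouquet_adj_irr.

(** Numbers a petal as in [k5_minus_edge]: 0 is the shared hub, and the shift by one makes 3 and 4
    the endpoints of the missing edge. *)
Definition petal_vertex (i : 'I_m) (a : nat) : vertex bouquet :=
  if a is b.+1 then Some (i, inord b) else None.

Lemma petal_vertex_inj i a b : (a < 5)%N -> (b < 5)%N ->
  petal_vertex i a = petal_vertex i b -> a = b.
Proof.
case: a b => [|a] [|b] //= a5 b5 [] /(congr1 val) /=.
by rewrite !inordK// => ->.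
Qed.

Lemma petal_vertex_adj i a b : k5_minus_edge a b ->
  adj (petal_vertex i a) (petal_vertex i b).
Proof.
case: a b => [|a] [|b] //= E; rewrite eqxx /= -val_eqE /=.
have [a4 b4] : (a < 4)%N /\ (b < 4)%N by move: E; rewrite /k5_minus_edge /=; lia.
by rewrite !inordK//; move: E; rewrite /k5_minus_edge /=; lia.
Qed.

Lemma bouquet_edge (e : edge bouquet) : exists i a b,
  k5_minus_edge a b /\ val e = [set petal_vertex i a; petal_vertex i b]%SET.
Proof.
have : val e \in edges bouquet by exact: valP.
have pe (j : 'I_m) (c : 'I_4) : petal_vertex j c.+1 = Some (j, c).
  by rewrite /= inord_val.
rewrite inE => /existsP[u /existsP[v /andP[uv /eqP ->]]].
move: u v uv => [[i a]|] [[j b]|] //=; first last.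
- move=> _; exists j, 0%N, b.+1; split; last by rewrite pe.
  by rewrite /k5_minus_edge /=; have := ltn_ord b; lia.
- move=> _; exists i, 0%N, a.+1; split; last by rewrite pe finset.setUC.
  by rewrite /k5_minus_edge /=; have := ltn_ord a; lia.
move=> /and3P[/eqP <- ab nab]; have := ltn_ord a; have := ltn_ord b => b4 a4.
rewrite -val_eqE /= in ab; case: (ltngtP a b) ab => // ab _.
- exists i, a.+1, b.+1; split; last by rewrite !pe.
  by rewrite /k5_minus_edge /=; lia.
- exists i, b.+1, a.+1; split; last by rewrite !pe finset.setUC.
  by rewrite /k5_minus_edge /=; lia.
Qed.

(** * Planarity of the bouquet *)

Section Planarity.
Variable R : realType.

(* The shear (x, y) |-> (x, i x + y) sends the cone 0 <= y < x to the cone of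
   slopes in [i, i+1), so distinct petals are drawn in disjoint cones. *)
Definition shear (i : nat) (x y : R) : R * R := (x, i%:R * x + y).

(** As [0 <= y < x], the index [i] is the integer part of the slope [(i x + y) / x]. *)
Lemma shear_inj i j x y x' y' : 0 <= y < x -> 0 <= y' < x' ->
  shear i x y = shear j x' y' -> [/\ i = j, x = x' & y = y'].
Proof.
move=> /andP[y0 yx] /andP[y'0 y'x] [xx' E]; rewrite -xx' in y'x E *.
have ij (k l : nat) z w : (k < l)%N -> 0 <= w -> z < x ->
    k%:R * x + z = l%:R * x + w -> False.
  move=> kl w0 zx F; have : k%:R + 1 <= l%:R :> R by rewrite natr1 ler_nat.
  by nra.
case: (ltngtP i j) E => [lij|lij|<-] E.
- by case: (ij _ _ _ _ lij y'0 yx E).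
- by case: (ij _ _ _ _ lij y0 y'x (esym E)).
- by split=> //; apply: addrI E.
Qed.

Definition bouquet_point (u : vertex bouquet) : R * R :=
  if u is Some (i, a) then shear i (base_x R a.+1) (base_y R a.+1) else 0.

Lemma bouquet_point_petal i a : (a < 5)%N ->
  bouquet_point (petal_vertex i a) = shear i (base_x R a) (base_y R a).
Proof.
case: a => [|a] a5 /=; first by rewrite /shear /base_x /base_y /= mulr0 addr0.
by rewrite inordK.
Qed.

Lemma base_cone a : (0 < a < 5)%N -> 0 <= base_y R a < base_x R a.
Proof.
by move: a => [|[|[|[|[|a]]]]] // _; rewrite /base_x /base_y /=; apply/andP; split; lra.
Qed.

Lemma base_point_inj a b : (a < 5)%N -> (b < 5)%N ->
  base_x R a = base_x R b -> base_y R a = base_y R b -> a = b.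
Proof.
move: a b => [|[|[|[|[|a]]]]] [|[|[|[|[|b]]]]] // _ _;
  rewrite /base_x /base_y /= => ? ?; exfalso; lra.
Qed.

Lemma bouquet_point_inj : injective bouquet_point.
Proof.
have cone (a : 'I_4) : 0 <= base_y R a.+1 < base_x R a.+1.
  by apply: base_cone; rewrite /= ltnS.
have nz i (a : 'I_4) : shear i (base_x R a.+1) (base_y R a.+1) = 0 -> False.
  by move=> [x0 _]; have := cone a; rewrite x0 => /andP[]; lra.
move=> [[i a]|] [[j b]|] //=; last 2 first.
- by move=> /nz.
- by move=> /esym /nz.
move=> /(shear_inj (cone a) (cone b))[/val_inj -> ex ey].
suff -> : a = b by [].
apply/val_inj/succn_inj; by apply: base_point_inj ex ey; rewrite ltnS.
Qed.

Definition petal_arc (i : 'I_m) (a b : nat) (t : R) : R * R :=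
  shear i (base_seg (base_x R) a b t) (base_seg (base_y R) a b t).

Lemma bouquet_planar : planar R bouquet.
Proof.
have /choice[f Hf] : forall e : edge bouquet, exists f : 'I_m * nat * nat,
    let: (i, a, b) := f in k5_minus_edge a b /\
    val e = [set petal_vertex i a; petal_vertex i b]%SET.
  by move=> e; have [i [a [b h]]] := bouquet_edge e; exists (i, a, b).
pose arc e := petal_arc (f e).1.1 (f e).1.2 (f e).2.
have fE e : k5_minus_edge (f e).1.2 (f e).2 by have := Hf e; case: (f e) => [[i a] b] [].
have fV e : val e = [set petal_vertex (f e).1.1 (f e).1.2; petal_vertex (f e).1.1 (f e).2]%SET.
  by have := Hf e; case: (f e) => [[i a] b] [].
have lt5 a b : k5_minus_edge a b -> (a < 5)%N /\ (b < 5)%N.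
  by rewrite /k5_minus_edge /=; lia.
have arc0 e : arc e 0 = bouquet_point (petal_vertex (f e).1.1 (f e).1.2).
  rewrite bouquet_point_petal; last by have [] := lt5 _ _ (fE e).
  by rewrite /arc /petal_arc /base_seg !mul0r !addr0.
have arc1 e : arc e 1 = bouquet_point (petal_vertex (f e).1.1 (f e).2).
  rewrite bouquet_point_petal; last by have [] := lt5 _ _ (fE e).
  by rewrite /arc /petal_arc /base_seg !mul1r !(addrC _ (_ - _)) !subrK.
have cone e (t : R) := base_seg_cone (fE e) (t := t).
have simple e : simple_arc (arc e).
  split.
    apply: continuous_subspaceT.
    have cseg (g : nat -> R) a b : continuous (base_seg g a b).
      move=> t; apply: cvgD; first exact: cvg_cst.
      by apply: cvgM; [exact: cvg_id|exact: cvg_cst].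
    apply: (@continuous_pair _ _ _ (base_seg (base_x R) _ _)
      (fun t => _ * base_seg (base_x R) _ _ t + base_seg (base_y R) _ _ t)).
      exact: cseg.
    move=> t; apply: cvgD; last exact: cseg.
    by apply: cvgM; [exact: cvg_cst|exact: cseg].
  move=> s t _ _ [ex]; rewrite ex => /addrI ey.
  exact: base_seg_inj (fE e) ex ey.
have ends e : [set arc e 0; arc e 1] = bouquet_point @` [set v | v \in val e].
  rewrite arc0 arc1 fV; apply/seteqP; split=> [q [->|->]|q [v /=]].
  - by eexists; [|reflexivity]; rewrite /= !inE eqxx.
  - by eexists; [|reflexivity]; rewrite /= !inE eqxx orbT.
  - by rewrite !inE => /orP[] /eqP -> <-; [left|right].
have vtx e v : ~ open_curve (arc e) (bouquet_point v).
  move=> [t /=]; rewrite in_itv /= => t01.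
  case: v => [[j c]|] /=; last first.
    by move=> [x0 _]; have := cone e t t01; rewrite x0 => /andP[]; lra.
  have ccone : 0 <= base_y R c.+1 < base_x R c.+1.
    by apply: base_cone; rewrite /= ltnS.
  move=> /(shear_inj (cone e t t01) ccone)[_ ex ey].
  by apply: (base_seg_vertex (fE e) _ t01 ex ey); rewrite ltnS.
exists (GraphDrawing bouquet_point_inj simple ends vtx) => e e' /eqP ee' /=.
apply/seteqP; split=> // q [[s /= s01 <-] [t t01]].
rewrite !in_itv /= in s01 t01.
(* A common point forces the same petal, since both open edges lie in the cones of their petals. *)
move=> /esym /(shear_inj (cone e s s01) (cone e' t t01))[/val_inj ei ex ey].
have [ea eb] := base_seg_disjoint (fE e) (fE e') s01 t01 ex ey.
by apply: ee'; apply: val_inj; rewrite /= (fV e) (fV e') ei ea eb.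
Qed.

End Planarity.
End Bouquet.

(** * The chain of clusters *)

Section ClusteredBouquet.
Variable m : nat.
Local Notation V := (vertex (bouquet m)).

(* The first cluster of the chain containing u: the clusters gain the two
   non-adjacent vertices of one petal at a time. *)
Definition level (u : V) : nat :=
  if u is Some (i, a) then if (a < 2)%N then 0%N else i.+1 else 0%N.

Lemma level_le u : (level u <= m)%N.
Proof. by case: u => [[i a]|] //=; case: ifP. Qed.

(** A caterpillar: the spine runs from [inr 0] to [inr m], and the cap at [m] makes the root its own
    parent. *)
Definition chain_parent (x : V + 'I_m.+1) : V + 'I_m.+1 :=
  match x with
  | inl u => inr (inord (level u))
  | inr k => inr (inord (minn k.+1 m))
  end.

(** An invariant that never decreases towards the root; it turns reachability into a comparison of
    levels. *)
Definition chain_height (x : V + 'I_m.+1) : nat :=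
  match x with inl u => level u | inr k => k end.

Lemma chain_height_parent x : (chain_height x <= chain_height (chain_parent x))%N.
Proof.
case: x => [u|k] /=; first by rewrite inordK ?ltnS ?level_le.
by rewrite inordK; have := ltn_ord k; lia.
Qed.

Lemma chain_connect_height x y :
  fconnect chain_parent x y -> (chain_height x <= chain_height y)%N.
Proof.
move=> /iter_findex <-; elim: (findex _ _ _) => //= n IH.
exact: leq_trans IH (chain_height_parent _).
Qed.

Lemma chain_connect (k l : 'I_m.+1) : (k <= l)%N ->
  fconnect chain_parent (inr k) (inr l).
Proof.
move=> kl; suff it n : (k + n <= m)%N ->
    iter n chain_parent (inr k) = inr (inord (k + n)).
  rewrite (_ : inr l = iter (l - k) chain_parent (inr k)) ?fconnect_iter//.
  by rewrite it subnKC ?inord_val//; exact: leq_ord.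
elim: n => [|n IH] nm; first by rewrite addn0 inord_val.
rewrite iterS IH /=; last by lia.
by rewrite inordK; [congr (inr (inord _)); lia|lia].
Qed.

Lemma chain_connect_inl u (l : 'I_m.+1) :
  fconnect chain_parent (inl u) (inr l) = (level u <= l)%N.
Proof.
apply/idP/idP => [/chain_connect_height //|ul].
apply: (connect_trans (y := inr (inord (level u)))); first exact: fconnect1.
by apply: chain_connect; rewrite inordK ?ltnS ?level_le.
Qed.

Lemma chain_parent_root : chain_parent (inr ord_max) = inr ord_max.
Proof.
by congr inr; apply: val_inj; rewrite /= inordK (minn_idPr _)//.
Qed.

Lemma chain_parent_reach x : fconnect chain_parent x (inr ord_max).
Proof.
by case: x => [u|k]; [rewrite chain_connect_inl level_le|rewrite chain_connect// leq_ord].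
Qed.

Definition chain_tree : rooted_tree :=
  RootedTree chain_parent_root chain_parent_reach.

Lemma chain_leafE (x : node chain_tree) : is_leaf x = if x is inl _ then true else false.
Proof.
case: x => [u|k].
  by apply/forallP => -[w|l]; apply/implyP => /= /eqP.
apply/negP => /forallP leaf.
case: k leaf => [[|k] km] leaf.
  (* Cluster 0 has no cluster below it, but the hub hangs from it. *)
  have /implyP := leaf (inl None); rewrite /= => h.
  suff : (inl None : node chain_tree) == inr ord_max by [].
  by apply: h; apply/eqP; congr inr; apply: val_inj; rewrite /= inordK.
have km' : (k < m.+1)%N by lia.
have /implyP := leaf (inr (Ordinal km')); rewrite /= => h.
suff /eqP[] : (inr (Ordinal km') : node chain_tree) == inr ord_max by lia.
by apply: h; apply/eqP; congr inr; apply: val_inj; rewrite /= inordK; lia.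
Qed.

Lemma chain_leafP (x : node chain_tree) : is_leaf x <-> exists u : V, inl u = x.
Proof.
rewrite chain_leafE; case: x => [u|k]; first by split=> // _; exists u.
by split=> // -[].
Qed.

Definition chain_leaf (u : V) : node chain_tree := inl u.

Lemma in_leaves_below u (l : 'I_m.+1) :
  (u \in leaves_below chain_leaf (inr l : node chain_tree)) = (level u <= l)%N.
Proof. by rewrite inE; exact: chain_connect_inl. Qed.

Lemma chain_leaf_inj : injective chain_leaf.
Proof. by move=> u v []. Qed.

Lemma leaves_below_inj :
  {in [pred x : node chain_tree | ~~ is_leaf x] &, injective (leaves_below chain_leaf)}.
Proof.
have lev (k l : 'I_m.+1) : (k < l)%N ->
    leaves_below chain_leaf (inr k : node chain_tree) =
    leaves_below chain_leaf (inr l : node chain_tree) -> False.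
  move=> kl /setP; have km : (k < m)%N by have := ltn_ord l; lia.
  (* An endpoint of the missing edge of petal [k] has level [k + 1], so it enters the chain just
     after cluster [k]. *)
  move=> /(_ (Some (Ordinal km, inord 2))); rewrite !in_leaves_below /=.
  by rewrite inordK//= ltnn kl.
move=> x y; rewrite !inE !chain_leafE; case: x y => [//|k] [//|l] _ _ kl.
case: (ltngtP k l) => [lt|lt|/val_inj -> //].
- by case: (lev _ _ lt).
- by case: (lev _ _ lt).
Qed.

Definition clustered_bouquet : clustered_graph :=
  ClusteredGraph chain_leaf_inj chain_leafP leaves_below_inj.

Lemma chain_not_leaf (k : 'I_m.+1) : ~~ is_leaf (inr k : node chain_tree).
Proof. by rewrite chain_leafE. Qed.

Definition chain_cluster (k : 'I_m.+1) : cg_cluster clustered_bouquet :=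
  exist (fun x => ~~ is_leaf x) (inr k : node chain_tree) (chain_not_leaf k).

Lemma chain_cluster_inj : injective chain_cluster.
Proof. by move=> k l /(congr1 val) []. Qed.

Lemma clusterP (mu : cg_cluster clustered_bouquet) : exists k, mu = chain_cluster k.
Proof.
case: mu => -[u|k] h; first by exfalso; move: h; rewrite chain_leafE.
by exists k; apply: val_inj.
Qed.

Lemma in_cluster u k :
  (u \in cluster_set (chain_cluster k)) = (level u <= k)%N.
Proof. exact: in_leaves_below. Qed.

Lemma clustered_bouquet_order : cg_order clustered_bouquet = (4 * m).+1.
Proof. by rewrite /cg_order /= card_option card_prod !card_ord mulnC. Qed.

(** The hub has level 0, so it lies in every cluster, and it is adjacent to all other vertices. *)
Lemma clustered_bouquet_connected : c_connected clustered_bouquet.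
Proof.
apply/forallP => mu; have [k ->] := clusterP mu.
have hub (u : V) : u \in cluster_set (chain_cluster k) ->
    connect (induced_adj (cluster_set (chain_cluster k))) u None /\
    connect (induced_adj (cluster_set (chain_cluster k))) None u.
  have Nk : (None : V) \in cluster_set (chain_cluster k) by rewrite in_cluster.
  move=> uk; have [->|uN] := eqVneq u None; first by split; exact: connect0.
  by split; apply: connect1; rewrite /induced_adj /= uk Nk; case: u uN {uk} => // -[].
apply/forall_inP => u uk; apply/forall_inP => v vk.
exact: connect_trans (hub u uk).1 (hub v vk).2.
Qed.

Lemma clustered_bouquet_not_flat : (1 < m)%N -> ~~ flat clustered_bouquet.
Proof.
(* Cluster 1 differs from the root because [1 < m], and it contains cluster 0. *)
move=> m1; apply/negP => /forallP /(_ (chain_cluster (inord 1))).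
move=> /forallP /(_ (chain_cluster (inord 0))) /implyP nsub.
have /negP : ~~ (cluster_set (chain_cluster (inord 0))
    \subset cluster_set (chain_cluster (inord 1))); last apply.
  apply: nsub; apply/andP; split.
  by apply/eqP => -[] /(congr1 val) /=; rewrite inordK; lia.
  by apply/eqP => /chain_cluster_inj /(congr1 val) /=; rewrite !inordK; lia.
by apply/fintype.subsetP => u; rewrite !in_cluster !inordK//; lia.
Qed.

(** * Counting the edge-region crossings *)

Variable R : realType.

(** For [k <= i] both endpoints of the missing edge of petal [i] have level [i + 1 > k], so the
    region of cluster [k] avoids them while it holds the vertices of the triangle. The edge that
    leaves must also return, which makes one crossing. *)
Lemma cluster_crosses_petal (D : drawing R clustered_bouquet)
    (K : edge (bouquet m) -> cg_cluster clustered_bouquet -> nat)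
    (k : 'I_m.+1) (i : 'I_m) :
  no_edge_edge_crossing D ->
  (forall e mu, (boundary_crossings D e mu #= `I_(K e mu))%card) ->
  (k <= i)%N ->
  exists a b e, [/\ (a < b < 3)%N,
    val e = [set petal_vertex i a; petal_vertex i b]%SET &
    (0 < (K e (chain_cluster k))./2)%N].
Proof.
move=> ncr HK ki; set mu := chain_cluster k.
have lv a : (a < 5)%N -> level (petal_vertex i a) = if (a < 3)%N then 0%N else i.+1.
  by case: a => [|a] //= a5; rewrite inordK.
have inmu a : (a < 5)%N ->
    region D mu (vertex_point D (petal_vertex i a)) <-> (a < 3)%N.
  move=> a5; rewrite region_vertex in_cluster lv//; case: ifP => // _.
  by split => //; lia.
have [||a [b [e [t [ab eE t01 nA]]]]] := @triangle_leaves_region R (bouquet m) D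
  (petal_vertex i) (region D mu) ncr (@petal_vertex_inj m i) (@petal_vertex_adj m i)
  (region_simple D mu).
- by move=> /(inmu 3%N isT).1.
- by move=> /(inmu 4%N isT).1.
exists a, b, e; split=> //.
have [a3 b3] : (a < 3)%N /\ (b < 3)%N by lia.
have endin s : s = 0 \/ s = 1 -> exists2 v, edge_arc D e s = vertex_point D v &
    region D mu (vertex_point D v).
  move=> s01; have : [set edge_arc D e 0; edge_arc D e 1] (edge_arc D e s).
    by case: s01 => ->; [left|right].
  rewrite edge_arc_ends => -[v /=]; rewrite eE !inE => /orP[] /eqP -> <-;
    by eexists; first reflexivity; apply/inmu; lia.
have [v0 e0 r0] := endin 0 (or_introl erefl).
have [v1 e1 r1] := endin 1 (or_intror erefl).
have := HK e mu; rewrite /boundary_crossings => /(arc_leaving_region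
  (edge_arc_simple D e) (closed_simple_closed_region (region_simple D mu))).
rewrite e0 e1 => /(_ t r0 r1 (@region_boundary _ _ D mu v0)
  (@region_boundary _ _ D mu v1) t01 nA).
by rewrite half_gt0.
Qed.

(** Each pair [k <= i] of indices below [m] yields a crossing of cluster [k] with an edge of petal
    [i], and such pairs number at least half of [m ^ 2]. *)
Lemma edge_region_crossings_ge (D : drawing R clustered_bouquet) beta :
  drawing_0_beta_0 D beta -> (m ^ 2 <= 2 * beta)%N.
Proof.
move=> [ncr [K [HK ->]] _]; rewrite exchange_big /=.
pose F k := (\sum_(e : edge (bouquet m)) (K e (chain_cluster k))./2)%N.
have sumF : (\sum_(k < m.+1) F k <=
    \sum_mu \sum_(e : edge (bouquet m)) (K e mu)./2)%N.
  rewrite -(big_imset (h := chain_cluster)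
    (fun mu => \sum_(e : edge (bouquet m)) (K e mu)./2)%N (A := 'I_m.+1)) /=.
    by rewrite [leqRHS](bigID (mem [set chain_cluster x | x in 'I_m.+1]%SET)) leq_addr.
  by move=> ? ? _ _; exact: chain_cluster_inj.
have Fge (k : 'I_m.+1) : (\sum_(i < m) (k <= i) <= F k)%N.
  have /choice[h Hh] : forall i : 'I_m, exists e : edge (bouquet m),
      exists a b, [/\ (a < b < 3)%N,
      val e = [set petal_vertex i a; petal_vertex i b]%SET &
      ((k <= i) <= (K e (chain_cluster k))./2)%N].
    move=> i; have [ki|ki] := leqP k i.
      have [a [b [e He]]] := cluster_crosses_petal ncr HK ki.
      by exists e, a, b.
    (* For [i < k] the bound is trivial, but an edge of petal [i] is still chosen so that [h] is
       injective. *)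
    have [e He] := edge_exists (petal_vertex_adj i (isT : k5_minus_edge 0 1)).
    by exists e, 0%N, 1%N.
  (* The larger index satisfies [b > 0], so this endpoint is not the hub and reveals the petal. *)
  have hinj : injective h.
    move=> i j hij; have [a [b [ab hi _]]] := Hh i.
    have [a' [b' [ab' hj _]]] := Hh j.
    have : petal_vertex i b \in val (h j) by rewrite -hij hi !inE eqxx orbT.
    case: b ab {hi} => [|b] ab; first by lia.
    have pe c : petal_vertex i b.+1 == petal_vertex j c -> i = j.
      by case: c => [|c] //= /eqP[].
    by rewrite hj !inE => /orP[] /pe.
  rewrite /F [leqRHS](bigID (mem [set h x | x in 'I_m]%SET)) /=.
  apply: leq_trans (leq_addr _ _).
  rewrite big_imset /=; last by move=> ? ? _ _; exact: hinj.
  by apply: leq_sum => i _; have [a [b []]] := Hh i.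
(* Adding the sum to its transpose counts every ordered pair at least once. *)
have half : (m ^ 2 <= 2 * \sum_(k < m) \sum_(i < m) (k <= i))%N.
  rewrite mul2n -addnn [X in (_ <= _ + X)%N]exchange_big -big_split /=.
  have <- : (\sum_(k < m) \sum_(i < m) 1 = m ^ 2)%N.
    by rewrite !sum_nat_const !card_ord muln1.
  apply: leq_sum => k _; rewrite -big_split; apply: leq_sum => i _ /=.
  by case: (leqP k i) => //= /ltnW ->.
apply: leq_trans half _; rewrite leq_mul2l; apply/orP; right.
(* The root cluster, [k = m], is dropped. *)
apply: leq_trans sumF; rewrite big_ord_recr /=.
apply: leq_trans (leq_addr _ _); apply: leq_sum => k _.
exact: (Fge (widen_ord (leqnSn m) k)).
Qed.

End ClusteredBouquet.

Theorem theorem9 (R : realType) :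
  exists C : nat -> clustered_graph,
    [/\ forall k, [/\ planar R (cg_graph (C k)), c_connected (C k)
                    & ~~ flat (C k)],
        forall N : nat, exists k, (N <= cg_order (C k))%N
      & exists2 c : R, 0 < c &
          exists n0 : nat, forall k, (n0 <= cg_order (C k))%N ->
            forall (D : drawing R (C k)) (beta : nat),
              drawing_0_beta_0 D beta ->
              c * (cg_order (C k))%:R ^+ 2 <= beta%:R].
Proof.
(* At least two petals, as non-flatness demands. *)
exists (fun k => clustered_bouquet k.+2); split.
- move=> k; split; first exact: bouquet_planar.
    exact: clustered_bouquet_connected.
  exact: clustered_bouquet_not_flat.
- by move=> N; exists N; rewrite clustered_bouquet_order; lia.
(* With [m = k + 2], the order is [4 m + 1 <= 5 m], so its square is at most
   [25 m ^ 2 <= 50 beta]. *)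
exists 50^-1; first by rewrite invr_gt0.
exists 0%N => k _ D beta /edge_region_crossings_ge m2.
rewrite clustered_bouquet_order mulrC ler_pdivrMr// -natrX -natrM ler_nat.
by nia.
Qed.
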